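(* The following inclusions of classes of distributions hold: $$\mathcal{J}\cap\mathcal{K}\subset\mathcal{OS}\cap\mathcal{K}\subset\mathcal{DK}^c .$$ That is, every heavy-tailed distribution in $\mathcal{J}$ is a heavy-tailed distribution in $\mathcal{OS}$, and every heavy-tailed distribution in $\mathcal{OS}$ belongs to $\mathcal{DK}^c$.
   Context: All distributions $F$ are probability distributions on $\mathbb{R}$ with unbounded support contained in $[0,\infty)$; $\overline F:=1-F$ denotes the tail of the distribution function $F$ (so $\overline F(x)>0$ for all $x$), and $F^{*2}$ the convolution of $F$ with itself. The symbol $\subset$ denotes (not necessarily proper) inclusion. $\mathcal{K}$ (heavy-tailed): $F\in\mathcal{K}$ iff $\int_0^\infty e^{\alpha y}\,dF(y)=\infty$ for all $\alpha>0$. $\mathcal{J}$ (principle of a single big jump): let $(X_i)_{i\ge1}$ be i.i.d. with distribution $F$, and let $X_{n,k}$ be the $k$-th largest among $X_1,\dots,X_n$. Then $F\in\mathcal{J}$ iff for all $n\ge2$, $$\lim_{K\to\infty}\liminf_{x\to\infty}\mathbb{P}\Big(X_{n,1}>x-K\ \Big|\ \sum_{i=1}^nX_i>x\Big)=1 .$$ $\mathcal{OS}$ (generalized subexponential): $F\in\mathcal{OS}$ iff $\limsup_{x\to\infty}\overline{F^{*2}}(x)/\overline F(x)<\infty$. $\mathcal{DK}^c$ (strongly heavy-tailed): $F\in\mathcal{DK}^c$ iff $\lim_{x\to\infty}e^{\lambda x}\overline F(x)=\infty$ for all $\lambda>0$. *)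

(* Defs.v *)
From mathcomp Require Import all_boot all_order all_algebra.
From mathcomp Require Import all_classical all_reals all_analysis.

Set Implicit Arguments.
Unset Strict Implicit.
Unset Printing Implicit Defensive.

Import Order.TTheory GRing.Theory Num.Theory.
Import numFieldNormedType.Exports.

Local Open Scope classical_set_scope.
Local Open Scope ring_scope.

Definition closed_support (R : realType) (mu : set R -> \bar R) : set R :=
  [set x | forall U : set R, open U -> U x -> (0 < mu U)%E].

Record halfline_dist (R : realType) := HalflineDist {
  law :> probability R R ;
  support_ge0 : closed_support law `<=` [set x | 0 <= x] ;
  support_unbounded : ~ bounded_set (closed_support law) }.

Definition tail (R : realType) (mu : set R -> \bar R) (x : R) : R :=
  fine (mu [set y | x < y]).

Definition conv2 (R : realType) (F : probability R R) : set R -> \bar R :=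
  pushforward (F \x F)%E (fun z : R * R => z.1 + z.2).

Definition cond_prob d (T : measurableType d) (R : realType)
    (P : probability T R) (A B : set T) : R :=
  fine (P (A `&` B)) / fine (P B).

Definition independent_RVs d (T : measurableType d) (R : realType)
    (P : probability T R) (n : nat) (X : 'I_n -> {RV P >-> R}) : Prop :=
  forall (J : {set 'I_n}) (A : 'I_n -> set R),
    (forall i, measurable (A i)) ->
    P (\bigcap_(i in [set` J]) (X i @^-1` A i)) =
    (\prod_(i in J) P (X i @^-1` A i))%E.

Definition iid d (T : measurableType d) (R : realType)
    (P : probability T R) (n : nat) (X : 'I_n -> {RV P >-> R})
    (F : probability R R) : Prop :=
  independent_RVs X /\
  forall (i : 'I_n) (A : set R), measurable A -> distribution P (X i) A = F A.

(* The k-th largest of x_0, ..., x_(n-1), with multiplicity; k is counted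
   from 1, and the default 0 of nth is only returned when k > n. *)
Definition kth_largest (R : realType) (n : nat) (x : 'I_n -> R) (k : nat) : R :=
  nth 0 (sort >=%R [seq x i | i : 'I_n]) k.-1.

Definition classK (R : realType) : set (halfline_dist R) :=
  [set F | forall alpha : R, 0 < alpha ->
    (\int[law F]_(y in [set y | (0 <= y)%R]) (expR (alpha * y)%R)%:E = +oo)%E].

(* The condition for n only depends on the joint law of X_1, ..., X_n, so it is
   imposed on every realisation of n i.i.d. variables with law F; one always
   exists, namely the coordinates on the n-fold product of F. *)
Definition classJ (R : realType) : set (halfline_dist R) :=
  [set F | forall n : nat, (2 <= n)%N ->
    forall (d : measure_display) (T : measurableType d) (P : probability T R)
      (X : 'I_n -> {RV P >-> R}), iid X F ->
    limf_einf (fun x : R =>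
        (cond_prob P
          [set w | x - K < kth_largest (fun i => X i w) 1]
          [set w | x < \sum_(i < n) X i w])%:E) (pinfty_nbhs R)
      @[K --> +oo] --> 1%:E].

Definition classOS (R : realType) : set (halfline_dist R) :=
  [set F | (limf_esup (fun x : R => (tail (conv2 F) x / tail F x)%:E)
              (pinfty_nbhs R) < +oo)%E].

Definition classDKc (R : realType) : set (halfline_dist R) :=
  [set F | forall lambda : R, 0 < lambda ->
    expR (lambda * x) * tail F x @[x --> +oo] --> +oo].

(* Main.v *)
Require Import Defs.
From mathcomp Require Import all_boot all_order all_algebra.
From mathcomp Require Import all_classical all_reals all_analysis.
From HB Require Import structures.
From mathcomp Require Import measurable_realfun lra ring.

(** Write T for the tail of F and S = X_1 + X_2 for two independent copies.
    Everything rests on the elementary bound T(a) T(b) <= P(S > a + b), from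
    the event that X_1 > a and X_2 > b ([tail_conv2_ge_mul]).

    A single big jump forces OS.  Taking n = 2, some K > 0 has
    P(max > x - K | S > x) > 1/2 for all large x, whence
    P(S > x) <= 2 P(max > x - K) <= 4 T(x - K) ([classJ_conv2_tail_le]).  It
    remains to see that a shift by K costs only a constant factor, and this
    follows by confronting that upper bound with the elementary lower bound at
    x + K: T(x - K) T(2K) <= P(S > x + K) <= 4 T(x).  Hence
    P(S > x) <= (16 / T(2K)) T(x) ([classJ_OS]).

    A heavy-tailed distribution in OS is strongly heavy-tailed.  In OS the
    elementary bound becomes T(a) T(b) <= C T(a + b), so that g = T / C is
    supermultiplicative ([classOS_tail_mul]).  If g(x) <= exp(- l x / 2) for
    every x > 0, an exponential moment of F would be finite
    ([exp_moment_lty]); so heavy-tailedness provides one x > 0 with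
    g(x) > exp(- l x / 2).  As in Fekete's lemma, this single point controls
    all larger ones: writing y = k x + r with 0 <= r < x,
    g(y) >= g(x)^k g(r) >= exp(- l y / 2) g(x), so exp(l y) T(y) grows at least
    like exp(l y / 2) ([classOSK_DKc]). *)

Set Implicit Arguments.
Unset Strict Implicit.
Unset Printing Implicit Defensive.

Import Order.TTheory GRing.Theory Num.Theory.
Import numFieldNormedType.Exports.

Local Open Scope classical_set_scope.
Local Open Scope ring_scope.

Section heavy_tails.
Context (R : realType).

(** * Tails and the elementary convolution bound *)

Lemma measurable_upper_ray (x : R) : measurable [set y : R | x < y].
Proof. by rewrite -set_itvoy; exact: measurable_itv. Qed.

Lemma fine_probability_le d (T : measurableType d) (P : probability T R)
    (A B : set T) : measurable A -> measurable B -> A `<=` B ->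
  fine (P A) <= fine (P B).
Proof.
move=> mA mB AB; apply: fine_le; rewrite ?fin_num_measure//.
by apply: le_measure => //; rewrite ?inE.
Qed.

Lemma tail_ge0 (F : probability R R) x : 0 <= tail F x.
Proof. exact/fine_ge0/measure_ge0. Qed.

Lemma tail_le1 (F : probability R R) x : tail F x <= 1.
Proof.
have mx := measurable_upper_ray x.
by rewrite -lee_fin fineK ?fin_num_measure//; exact: probability_le1.
Qed.

Lemma tail_nincr (F : probability R R) x y : x <= y -> tail F y <= tail F x.
Proof.
move=> xy; apply: fine_probability_le; [exact: measurable_upper_ray..|].
by move=> z /=; exact: le_lt_trans.
Qed.

Lemma halfline_tail_gt0 (F : halfline_dist R) x : 0 < tail F x.
Proof.
(* Otherwise x would bound the support, which already lies in [0, +oo). *)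
have [y Fy xy] : exists2 y, closed_support F y & x < y.
  apply: contrapT => nex; apply: (@support_unbounded _ F).
  exists `|x|; split=> [|M xM y Fy]; first exact: num_real.
  have y0 := support_ge0 Fy.
  rewrite /= ger0_norm//; apply: ltW; apply: le_lt_trans xM.
  rewrite (le_trans _ (ler_norm _))// leNgt; apply/negP => xy.
  by apply: nex; exists y.
rewrite fine_gt0//; apply/andP; split.
  by apply: Fy => //; exact: open_gt.
rewrite (le_lt_trans _ (ltry 1))//.
by apply: probability_le1; exact: measurable_upper_ray.
Qed.

Lemma measurable_pair_sum (A : set R) : measurable A ->
  measurable ((fun z : R * R => z.1 + z.2) @^-1` A).
Proof.
move=> mA; rewrite -[X in measurable X]setTI.
by apply: measurable_funD.
Qed.

Lemma tail_conv2_ge_mul (F : probability R R) a b :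
  tail F a * tail F b <= tail (conv2 F) (a + b).
Proof.
have ma := measurable_upper_ray a; have mb := measurable_upper_ray b.
rewrite -fineM ?fin_num_measure// -product_measure1E//.
rewrite /tail /conv2 /pushforward; apply: fine_probability_le.
- exact: measurableX.
- by apply: measurable_pair_sum; exact: measurable_upper_ray.
- by move=> -[y z] [/= ay bz]; exact: ltrD.
Qed.

(** * Exponential moments *)

(** Cutting the half-line into unit intervals, the k-th piece contributes at
    most exp(a (k + 1)) T(k - 1), a term of a convergent geometric series once
    T decays at twice the rate a. *)
Lemma exp_moment_lty (F : probability R R) (a C : R) : 0 < a ->
  (forall x, tail F x <= C * expR (- (a * 2 * x))) ->
  (\int[F]_(y in [set y | (0 <= y)%R]) (expR (a * y)%R)%:E < +oo)%E.
Proof.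
move=> a0 TC.
pose I (k : nat) := [set y : R | k%:R <= y < k.+1%:R].
have mI k : measurable (I k) by rewrite /I -set_itvco; exact: measurable_itv.
have mexp : measurable_fun setT (fun y : R => (expR (a * y)%R)%:E).
  apply/measurable_EFinP; apply: measurableT_comp; first exact: measurable_expR.
  by apply: measurable_funM => //; exact: measurable_id.
have -> : [set y : R | 0 <= y] = \bigcup_k I k.
  apply/seteqP; split=> [y y0|y [k _ /andP[ky _]]]; last exact: le_trans ky.
  by exists (Num.trunc y) => //; exact: truncn_itv.
rewrite ge0_integral_bigcup//; last 2 first.
- exact: measurable_funTS mexp.
- move=> i j _ _ [y [/= /truncn_def <- /truncn_def <-]] //.
have piece k : (\int[F]_(y in I k) (expR (a * y))%:E <=
    (geometric (C * expR (a * 3)) (expR (- a)) k)%:E)%E.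
  (* The ray starts at k - 1 because a tail is the mass of an open ray, which
     at k would miss the left endpoint of I k. *)
  have FI : (F (I k) <= (C * expR (- (a * 2 * (k%:R - 1))))%:E)%E.
    apply: (@le_trans _ _ (tail F (k%:R - 1))%:E); last by rewrite lee_fin.
    have mr := measurable_upper_ray (k%:R - 1 : R).
    rewrite fineK ?fin_num_measure//; apply: le_measure; rewrite ?inE//.
    by move=> y /= /andP[ky _]; apply: lt_le_trans ky; rewrite ltrBlDr ltrDl.
  have mk : measurable_fun (I k) (fun y : R => (expR (a * y)%R)%:E).
    exact: measurable_funTS mexp.
  apply: (@le_trans _ _ (\int[F]_(y in I k) (cst (expR (a * k.+1%:R))%:E y))%E).
    apply: ge0_le_integral => //.
    by move=> y /= /andP[_ yk]; rewrite lee_fin ler_expR ler_pM2l// ltW.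
  rewrite integral_cst//.
  apply: (le_trans (lee_wpmul2l _ FI)); first by rewrite lee_fin expR_ge0.
  rewrite /geometric /= -expRM_natl -EFinM lee_fin mulrCA -[leRHS]mulrA -!expRD.
  rewrite -natr1 le_eqVlt; apply/orP; left; apply/eqP.
  by congr (_ * expR _); ring.
apply: (@le_lt_trans _ _ (\sum_(0 <= k <oo)
    (geometric (C * expR (a * 3)) (expR (- a)) k)%:E)%E).
  apply: lee_nneseries => [k _ _|k _]; last exact: piece.
  by apply: integral_ge0 => y _; rewrite lee_fin expR_ge0.
have /cvg_geometric_series h : `|expR (- a)| < 1.
  by rewrite ger0_norm ?expR_ge0// expR_lt1 oppr_lt0.
have -> : (\sum_(0 <= k <oo) (geometric (C * expR (a * 3)) (expR (- a)) k)%:E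
    = (C * expR (a * 3) / (1 - expR (- a)))%:E)%E.
  apply: cvg_lim => //; under eq_fun do rewrite sumEFin.
  by apply: cvg_EFin; [exact: nearW|exact: h].
exact: ltry.
Qed.

(** * From OS to strong heavy-tailedness *)

Lemma classOSP (F : halfline_dist R) : classOS F <->
  exists C, \forall x \near +oo, tail (conv2 F) x <= C * tail F x.
Proof.
split.
- move=> /ereal_inf_lt[_ [V FV <-]] supV.
  have [C hC] : exists C : R,
      (ereal_sup [set (tail (conv2 F) x / tail F x)%:E | x in V] <= C%:E)%E.
    case: (ereal_sup _) supV => [r _|//|_]; first by exists r.
    by exists 0; exact: leNye.
  exists C; apply: filterS FV => x Vx.
  rewrite -ler_pdivrMr ?halfline_tail_gt0// -lee_fin; apply: le_trans hC.
  by apply: ereal_sup_ubound; exists x.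
- move=> [C FC]; apply: le_lt_trans (ltry C).
  apply: ereal_inf_le; exists (ereal_sup [set (tail (conv2 F) x / tail F x)%:E |
     x in [set x | tail (conv2 F) x <= C * tail F x]]).
    by exists [set x | tail (conv2 F) x <= C * tail F x].
  apply: ge_ereal_sup => _ [x Vx <-].
  by rewrite lee_fin ler_pdivrMr ?halfline_tail_gt0.
Qed.

(** The OS bound only holds beyond some M; below M the tail is at least T(M),
    so enlarging the constant to 1 / T(M) makes the inequality global. *)
Lemma classOS_tail_mul (F : halfline_dist R) : classOS F ->
  exists2 C, 1 <= C & forall a b, tail F a * tail F b <= C * tail F (a + b).
Proof.
move=> /classOSP[C [M [_ CM]]].
exists (Num.max 1 (Num.max C (tail F M)^-1)) => [|a b].
  by rewrite le_max lexx.
have T0 x : 0 < tail F x by exact: halfline_tail_gt0.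
have [Mab|abM] := ltP M (a + b).
  rewrite (le_trans (tail_conv2_ge_mul _ _ _))// (le_trans (CM _ Mab))//.
  by rewrite ler_pM2r// !le_max lexx orbT.
apply: (@le_trans _ _ ((tail F M)^-1 * tail F (a + b))); last first.
  by rewrite ler_pM2r// !le_max lexx !orbT.
apply: (@le_trans _ _ 1); first by rewrite mulr_ile1// ?tail_ge0 ?tail_le1.
by rewrite mulrC ler_pdivlMr// mul1r tail_nincr.
Qed.

Lemma supermul_iter (g : R -> R) x r n :
  (forall a, 0 <= g a) -> (forall a b, g a * g b <= g (a + b)) ->
  g x ^+ n * g r <= g (n%:R * x + r).
Proof.
move=> g0 gM; elim: n => [|n IHn]; first by rewrite mul1r mul0r add0r.
rewrite exprS -mulrA (le_trans (ler_wpM2l (g0 _) IHn))//.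
by rewrite (le_trans (gM _ _))// addrA [n.+1%:R]mulrS mulrDl mul1r.
Qed.

Lemma classOSK_DKc (F : halfline_dist R) : classOS F -> classK F -> classDKc F.
Proof.
move=> /classOS_tail_mul[C C1 CM] KF l l0.
have C0 : 0 < C by exact: lt_le_trans C1.
pose g x := tail F x / C.
have g0 x : 0 < g x by rewrite divr_gt0// halfline_tail_gt0.
have gM a b : g a * g b <= g (a + b).
  rewrite /g mulrACA mulrA ler_pM2r ?invr_gt0//.
  by rewrite ler_pdivrMr// [leRHS]mulrC; exact: CM.
(* A quarter of l: decay at rate l / 2 makes the moment at half that rate
   finite. *)
have l4 : 0 < l / 4 by rewrite divr_gt0.
have [x x0 gx] : exists2 x, 0 < x & expR (- (l / 2 * x)) < g x.
  apply: contrapT => nex.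
  suff : (\int[law F]_(y in [set y | (0 <= y)%R])
      (expR (l / 4 * y)%R)%:E < +oo)%E.
    by rewrite (KF _ l4).
  apply: (exp_moment_lty (C := C) l4) => x.
  have -> : l / 4 * 2 = l / 2 by field.
  have [x0|x0] := ltP 0 x.
    rewrite mulrC -ler_pdivrMr// leNgt; apply/negP => ?.
    by apply: nex; exists x.
  rewrite (le_trans (tail_le1 _ _))// (le_trans C1)// ler_peMr ?(ltW C0)//.
  by rewrite -expR0 ler_expR oppr_ge0 mulr_ge0_le0// divr_ge0// ltW.
(* Fekete: the bound at x propagates along the multiples of x, and the
   remainder r <= x costs at most the factor g x. *)
have gy y : 0 <= y -> expR (- (l / 2 * y)) * g x <= g y.
  move=> y0; pose k := Num.trunc (y / x); pose r := y - k%:R * x.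
  have /andP[ky yk] : k%:R <= y / x < k.+1%:R.
    by apply: truncn_itv; rewrite divr_ge0// ltW.
  have r0 : 0 <= r by rewrite subr_ge0 -ler_pdivlMr.
  have rx : r <= x.
    by rewrite lerBlDr -{1}[x]mul1r -mulrDl addrC natr1 -ler_pdivrMr// ltW.
  have -> : y = k%:R * x + r by rewrite addrC subrK.
  apply: (@le_trans _ _ (g x ^+ k * g r)); last first.
    by apply: supermul_iter => // a; exact: ltW.
  apply: ler_pM; rewrite ?expR_ge0 ?(ltW (g0 _))//; last first.
    by rewrite ler_pM2r ?invr_gt0// tail_nincr.
  apply: (@le_trans _ _ (expR (- (l / 2 * x)) ^+ k)); last first.
    by apply: lerXn2r; rewrite ?nnegrE ?expR_ge0 ?ltW.
  rewrite -expRM_natl ler_expR mulrN mulrCA lerN2 ler_pM2l ?divr_gt0//.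
  by rewrite lerDl.
(* Half of the exponent is left over, and exp(l y / 2) >= l y / 2. *)
apply/cvgryPge => A.
exists (Num.max 0 (A / tail F x / (l / 2))); split; first exact: num_real.
move=> y; rewrite gt_max => /andP[y0 Ay].
have Tx := halfline_tail_gt0 F x.
have l2 : 0 < l / 2 by rewrite divr_gt0.
have {}Ay : A <= expR (l / 2 * y) * tail F x.
  rewrite -ler_pdivrMr//; move: Ay.
  rewrite ltr_pdivrMr// [ltRHS]mulrC => /ltW /le_trans; apply.
  by rewrite (le_trans _ (expR_ge1Dx _))// lerDr.
apply: le_trans Ay _.
have := gy _ (ltW y0); rewrite /g mulrA ler_pM2r ?invr_gt0//.
rewrite -(@ler_pM2l _ (expR (l * y))) ?expR_gt0// mulrA -expRD.
by have -> : l * y + - (l / 2 * y) = l / 2 * y by field.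
Qed.

(** * A pair of independent copies *)

Definition coord (i : 'I_2) (z : R * R) : R := if i == ord0 then z.1 else z.2.

Let measurable_coord i : measurable_fun setT (coord i).
Proof.
rewrite /coord; case: (i == ord0); first exact: measurable_fst.
exact: measurable_snd.
Qed.

HB.instance Definition _ i :=
  isMeasurableFun.Build _ _ _ _ (coord i) (measurable_coord i).

(** The two coordinates on the product of F with itself: the realisation on
    which the single big jump condition is tested. *)
Definition coordRV (F : probability R R) (i : 'I_2) : {RV (F \x F)%E >-> R} :=
  coord i.

Lemma iid_coordRV (F : probability R R) : iid (coordRV F) F.
Proof.
(* Both independence and the marginals are instances of the product formula
   for boxes, with unconstrained coordinates replaced by the whole line. *)
have coordE (A : 'I_2 -> set R) : (forall i, measurable (A i)) ->
    (F \x F)%E (\bigcap_i (coord i @^-1` A i)) = (F (A ord0) * F (A ord_max))%E.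
  move=> mA; rewrite -product_measure1E//; congr ((F \x F)%E _).
  apply/seteqP; split=> [z Az|z [A0 A1] i _].
    by split; [exact: (Az ord0)|exact: (Az ord_max)].
  rewrite /preimage/= /coord; case: eqP => [->//|].
  case: i => [[|[|i]] i2] //= i0; first by case: i0; exact/val_inj.
  by rewrite (_ : Ordinal i2 = ord_max)//; exact/val_inj.
have marg i (A : set R) : measurable A -> (F \x F)%E (coord i @^-1` A) = F A.
  move=> mA.
  have mB j : measurable (if j == i then A else setT) by case: ifP.
  rewrite -[LHS](_ : (F \x F)%E
      (\bigcap_j (coord j @^-1` (if j == i then A else setT))) = _).
    rewrite coordE//.
    by case: i {mB} => [[|[|i]] i2] //=; rewrite probability_setT ?mule1 ?mul1e.
  congr ((F \x F)%E _); apply/seteqP; split=> [z /(_ i I)|z Az j _].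
    by rewrite /= eqxx.
  by rewrite /=; case: eqP => [->|].
split; last by move=> i A mA; exact: marg.
move=> J A mA.
pose B i := if i \in J then A i else setT.
have mB i : measurable (B i) by rewrite /B; case: ifP.
have -> : \bigcap_(i in [set` J]) (coordRV F i @^-1` A i) =
          \bigcap_i (coord i @^-1` B i).
  rewrite [LHS]bigcap_mkcond; apply: eq_bigcapr => i _; rewrite /B mem_setE.
  by case: ifP => _; rewrite ?preimage_setT.
rewrite [LHS]coordE// [RHS]big_mkcond/= big_ord_recl big_ord1.
have BE i : F (B i) =
    if i \in J then (F \x F)%E (coordRV F i @^-1` A i) else 1%E.
  by rewrite /B; case: ifP => _; rewrite ?probability_setT// [RHS]marg.
rewrite !BE (_ : lift ord0 ord0 = ord_max)//; exact/val_inj.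
Qed.

(** * From a single big jump to OS *)

Lemma kth_largest1_in n (x : 'I_n.+1 -> R) : exists i, kth_largest x 1 = x i.
Proof.
have : kth_largest x 1 \in [seq x i | i : 'I_n.+1].
  by rewrite -(mem_sort >=%R) mem_nth// size_sort size_map size_enum_ord.
by move=> /mapP[i _ ->]; exists i.
Qed.

Lemma kth_largest1_ge n (x : 'I_n -> R) i : x i <= kth_largest x 1.
Proof.
have xi : x i \in sort >=%R [seq x i | i : 'I_n].
  by rewrite mem_sort map_f// mem_enum.
rewrite /kth_largest; have : sorted >=%R (sort >=%R [seq x i | i : 'I_n]).
  by apply: sort_sorted => a b; exact: le_total.
case: sort xi => [//|y s]; rewrite inE => /predU1P[->//|ys] /=.
by move=> /(order_path_min (rev_trans le_trans)) /allP; exact.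
Qed.

(** The limit in K exceeds 1/2, so one fixed K makes the conditional
    probability exceed 1/2 for all large x; the union bound over the two
    summands gives the other factor 2. *)
Lemma classJ_conv2_tail_le (F : halfline_dist R) : classJ F ->
  exists2 K, 0 < K & \forall x \near +oo,
    tail (conv2 F) x <= 4 * tail F (x - K).
Proof.
move=> /(_ 2%N isT _ _ _ _ (iid_coordRV F)) /= J.
have : \forall K \near +oo, 0 < K /\ (limf_einf (fun x : R =>
    (cond_prob (F \x F)%E
      [set w | (x - K < kth_largest (fun i => coordRV F i w) 1)%R]
      [set w | (x < \sum_(i < 2) coordRV F i w)%R])%:E) (pinfty_nbhs R)
    > 2^-1%:E)%E.
  near=> K; split; first by near: K; exact: nbhs_pinfty_gt.
  near: K; apply: (J [set y | (2^-1%:E < y)%E]).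
  apply: open_nbhs_nbhs; split; first exact: open_ereal_gt_ereal.
  by rewrite /= lte_fin invf_lt1// ltr1n.
move=> /filter_ex[K [K0]]; rewrite limf_einfE => /ereal_sup_gt[_ [V FV <-] hV].
exists K => //; apply: filterS FV => x Vx.
set S := [set w | (x < \sum_(i < 2) coordRV F i w)%R] in hV.
set B := [set w | (x - K < kth_largest (fun i => coordRV F i w) 1)%R] in hV.
have : 2^-1 < cond_prob (F \x F)%E B S.
  rewrite -lte_fin; apply: lt_le_trans hV _.
  by apply: ereal_inf_lbound; exists x.
have SE : S = [set z : R * R | x < z.1 + z.2].
  by apply/seteqP; split=> z; rewrite /S /= big_ord_recl big_ord1.
have mS : measurable S.
  rewrite SE; apply: (@measurable_pair_sum [set y | x < y]).
  exact: measurable_upper_ray.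
have mC i : measurable (coord i @^-1` [set y | x - K < y]).
  rewrite -[X in measurable X]setTI; apply: measurable_coord => //.
  exact: measurable_upper_ray.
have -> : tail (conv2 F) x = fine ((F \x F)%E S) by rewrite SE.
rewrite /cond_prob => hBS.
(* A null conditioning event would give the ratio the value 0. *)
have S0 : 0 < fine ((F \x F)%E S).
  rewrite lt0r fine_ge0// andbT; apply/eqP => S0.
  by move: hBS; rewrite S0 invr0 mulr0 ltNge invr_ge0 ler0n.
suff BS : fine ((F \x F)%E (B `&` S)) <= 2 * tail F (x - K).
  by move: hBS; rewrite ltr_pdivlMr//; lra.
have BE : B = (coord ord0 @^-1` [set y | x - K < y]) `|`
              (coord ord_max @^-1` [set y | x - K < y]).
  apply/seteqP; split=> [z|z [|]]; rewrite /B /=.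
  - have [i ->] := kth_largest1_in (fun i => coord i z).
    case: (eqVneq i ord0) => [->|i0]; first by left.
    by rewrite /coord (negbTE i0) => xz; right.
  - move=> /lt_le_trans; apply; exact: (kth_largest1_ge (coord^~ z)).
  - move=> /lt_le_trans; apply; exact: (kth_largest1_ge (coord^~ z)).
have FC i :
    (F \x F)%E (coord i @^-1` [set y | x - K < y]) = (tail F (x - K))%:E.
  have mr := measurable_upper_ray (x - K).
  rewrite fineK ?fin_num_measure//.
  by have [_ /(_ i _ mr)] := iid_coordRV F.
have mB : measurable B by rewrite BE; exact: measurableU.
have mBS := measurableI _ _ mB mS.
have Bfin : (F \x F)%E (B `&` S) \is a fin_num
  by exact: (fin_num_measure ((F \x F)%E : probability _ R) _ mBS).
rewrite -lee_fin fineK// EFinM mule_natl mule2n -{1}(FC ord0) -(FC ord_max).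
apply: le_trans (measureU2 _ _ _) => //.
by apply: le_measure; rewrite ?inE// -BE.
Unshelve. all: by end_near. Qed.

(** The upper bound at x + K, against the lower bound from the splitting
    x + K = (x - K) + 2 K, yields T(x - K) <= (4 / T(2 K)) T(x). *)
Lemma classJ_OS (F : halfline_dist R) : classJ F -> classOS F.
Proof.
move=> /classJ_conv2_tail_le[K K0 [M [_ FM]]]; apply/classOSP.
have T0 x : 0 < tail F x by exact: halfline_tail_gt0.
exists (16 / tail F (2 * K)), (M + K); split=> [|x Mx]; first exact: num_real.
have Mx1 : M < x by rewrite (lt_trans _ Mx)// ltrDl.
have Mx2 : M < x + K by rewrite (lt_trans Mx1)// ltrDl.
apply: (le_trans (FM _ Mx1)).
have h := tail_conv2_ge_mul F (x - K) (2 * K).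
rewrite (_ : x - K + 2 * K = x + K) in h; last by ring.
have := le_trans h (FM _ Mx2).
rewrite addrK mulrAC ler_pdivlMr// => h2.
by rewrite -mulrA; move: h2; lra.
Qed.

End heavy_tails.

Theorem theorem1p1 (R : realType) :
  (@classJ R `&` @classK R `<=` @classOS R `&` @classK R) /\
  (@classOS R `&` @classK R `<=` @classDKc R).
Proof.
split=> [F [JF KF]|F [OSF KF]]; last exact: classOSK_DKc.
by split=> //; exact: classJ_OS.
Qed.
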